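(* Let $G=(V,E)$ be a finite DAG. The Euclidean closures of the open cones $\operatorname{cone}_G(C)$, for $C\in\mathbb{R}^E$ generic, together with their faces, form a complete polyhedral fan $\mathcal{F}_G$ in $\mathbb{R}^E$. The maximal cones of $\mathcal{F}_G$ are in bijection with the generic maxoids of $G$. Moreover, the function $\Phi$ which sends a cone of $\mathcal{F}_G$ to its maxoid is an inclusion-reversing surjection onto the set $\{\mathcal{M}_*(G,C):C\in\mathbb{R}^E\}$ of all maxoids of $G$: for all $F_1,F_2\in\mathcal{F}_G$, $$F_1\text{ is a face of }F_2\ \Longrightarrow\ \Phi(F_1)\supseteq\Phi(F_2).$$
   Context: Let $G=(V,E)$ be a finite DAG. $\mathbb{R}^E$ denotes the set of weight matrices supported on $G$: $V\times V$ matrices $C=(c_{ij})$ with $c_{ij}\in\mathbb{R}$ if $i\to j\in E$ and $c_{ij}=-\infty$ otherwise (identified with the Euclidean space indexed by $E$). For distinct $i,j\in V$, $P(i,j)$ is the set of directed paths from $i$ to $j$ in $G$, and the weight of a path $\pi$ is $\omega_C(\pi)=\sum_{e\in\pi}c_e$. A path in $P(i,j)$ is critical (for $(G,C)$) if its weight is maximal among all paths in $P(i,j)$. $C$ is generic if for all distinct $i,j$ with $P(i,j)\ne\emptyset$ there is exactly one critical path from $i$ to $j$. For $L\subseteq V$, the critical DAG $G^*_{C,L}$ is the DAG on $V$ with an edge $i\to j$ ($i\neq j$) if and only if $P(i,j)\neq\emptyset$ and no critical path from $i$ to $j$ in $(G,C)$ has an interior node in $L$. Distinct $i,j\in V\setminus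 L$ are $C^*$-connected given $L$ if $G^*_{C,L}$ contains, up to exchanging $i$ and $j$, a path of one of the forms (a) $i\to j$; (b) $i\leftarrow p\to j$; (c) $i\to \ell\leftarrow j$; (d) $i\leftarrow p\to\ell\leftarrow j$; (e) $i\leftarrow p\to\ell\leftarrow q\to j$, with $\ell\in L$ and $p,q\notin L$. Otherwise they are $C^*$-separated given $L$. For pairwise disjoint $I,J,L\subseteq V$, $I$ and $J$ are $C^*$-separated given $L$ if every $i\in I$ and $j\in J$ are $C^*$-separated given $L$. The maxoid $\mathcal{M}_*(G,C)$ is the set of all triples (CI statements) $[I\perp\!\!\!\perp J\mid L]$ with $I,J,L$ pairwise disjoint such that $I$ and $J$ are $C^*$-separated given $L$ in $(G,C)$. A generic maxoid of $G$ is one of the form $\mathcal{M}_*(G,C)$ with $C\in\mathbb{R}^E$ generic. For generic $C$, $\operatorname{cone}_G(C)=\{C'\in\mathbb{R}^E: C'\text{ generic},\ \mathcal{M}_*(G,C')=\mathcal{M}_*(G,C)\}$. A polyhedral cone is a finite intersection of closed linear half-spaces. A polyhedral fan is a finite collection of non-empty polyhedral cones closed under taking non-empty faces and such that any two cones intersect in a common face; it is complete if its cones cover the space. The maxoid of a cone $F\in\mathcal{F}_G$ is $\Phi(F)=\mathcal{M}_*(G,C)$ for $C$ in the relative interior of $F$ (it does not depend on the choice of $C$). *)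

(* Defs.v *)
From HB Require Import structures.
From mathcomp Require Import all_boot all_order all_algebra.
From mathcomp Require Import all_classical all_reals all_analysis.

Set Implicit Arguments.
Unset Strict Implicit.
Unset Printing Implicit Defensive.

Import Order.TTheory GRing.Theory Num.Theory.
Import numFieldNormedType.Exports.

Local Open Scope classical_set_scope.
Local Open Scope ring_scope.

Section PolyhedralGeometry.
Variables (R : realType) (n : nat).
Implicit Types (A F P : set 'rV[R]_n) (Fan : set (set 'rV[R]_n)).

Definition dot (a x : 'rV[R]_n) : R := \sum_k a 0 k * x 0 k.

Definition open_cone A : Prop :=
  open A /\
  forall (s t : R) (x y : 'rV[R]_n),
    0 < s -> 0 < t -> A x -> A y -> A (s *: x + t *: y).

(* The entries of [s] are inner normals; [s = [::]] gives the whole space. *)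
Definition polyhedral_cone P : Prop :=
  exists2 s : seq 'rV[R]_n, 0 \notin s &
    P = [set x | forall a, a \in s -> 0 <= dot a x].

(* A face is cut out by a valid inequality [c <= dot a x], which may be
   trivial: [P] is a face of itself, and the empty set is a face. *)
Definition face F P : Prop :=
  exists (a : 'rV[R]_n) (c : R),
    (forall x, P x -> c <= dot a x) /\
    F = P `&` [set x | dot a x = c].

Definition polyhedral_fan Fan : Prop :=
  [/\ finite_set Fan,
      forall P, Fan P -> P !=set0 /\ polyhedral_cone P,
      forall F P, Fan P -> face F P -> F !=set0 -> Fan F &
      forall P1 P2, Fan P1 -> Fan P2 ->
        face (P1 `&` P2) P1 /\ face (P1 `&` P2) P2].

Definition complete_fan Fan : Prop :=
  polyhedral_fan Fan /\ \bigcup_(P in Fan) P = setT.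

Definition maximal_cones Fan : set (set 'rV[R]_n) :=
  [set P | Fan P /\ forall Q, Fan Q -> P `<=` Q -> Q = P].

Definition affine_hull A : set 'rV[R]_n :=
  [set y | exists (m : nat) (x : 'I_m -> 'rV[R]_n) (l : 'I_m -> R),
    [/\ forall k, A (x k), \sum_k l k = 1 & y = \sum_k l k *: x k]].

Definition relative_interior A : set 'rV[R]_n :=
  [set x | A x /\ \forall y \near within (affine_hull A) (nbhs x), A y].

End PolyhedralGeometry.

Definition acyclic (V : finType) (E : rel V) : Prop :=
  forall c : seq V, cycle E c -> c = [::].

Section Maxoids.
Variables (R : realType) (V : finType) (E : rel V).

Definition edge : finType := {e : V * V | E e.1 e.2}.

(* R^E is ['rV[R]_#|edge|], with coordinates listed along the enumeration of
   [edge]. *)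
Implicit Types (C : 'rV[R]_#|edge|) (L : {set V}) (i j : V) (p q : seq V).

Definition weight_entry C i j : \bar R :=
  if insub (i, j) is Some e then (C 0 (enum_rank (e : edge)))%:E else -oo%E.

(* A path from [i] to [j] is given by the sequence [p] of its nodes other than
   the source [i]; when [E] is acyclic these nodes are pairwise distinct. *)
Definition dipath i j p : bool := path E i p && (last i p == j).

Definition path_weight C i p : \bar R :=
  (\sum_(e <- zip (i :: p) p) weight_entry C e.1 e.2)%E.

Definition critical C i j p : Prop :=
  dipath i j p /\
  forall q, dipath i j q -> (path_weight C i q <= path_weight C i p)%E.

Definition generic C : Prop :=
  forall i j, i != j -> (exists p, dipath i j p) -> exists! p, critical C i j p.

Definition interior_nodes i p : seq V := behead (belast i p).

Definition critical_edge C L i j : Prop :=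
  [/\ i != j, exists p, dipath i j p &
      forall p, critical C i j p -> forall k, k \in interior_nodes i p ->
        k \notin L].

(* The nodes are not required to be distinct: degenerate instances of the last
   two patterns contain, up to exchanging [i] and [j], an instance of
   one of the first two. *)
Definition star_path C L i j : Prop :=
  let G := critical_edge C L in
  G i j \/
  (exists p : V, [/\ p \notin L, G p i & G p j]) \/
  (exists l : V, [/\ l \in L, G i l & G j l]) \/
  (exists p l : V, [/\ p \notin L, l \in L & [/\ G p i, G p l & G j l]]) \/
  (exists p l q : V, [/\ p \notin L, l \in L, q \notin L &
     [/\ G p i, G p l, G q l & G q j]]).

Definition star_connected C L i j : Prop :=
  star_path C L i j \/ star_path C L j i.

Definition ci_statement : Type := ({set V} * {set V} * {set V})%type.

Definition maxoid C : set ci_statement :=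
  [set t : ci_statement | let: (A, B, L) := t in
    [/\ [disjoint A & B]%B, [disjoint A & L]%B, [disjoint B & L]%B &
        forall i j, i \in A -> j \in B -> ~ star_connected C L i j]].

Definition maxoids : set (set ci_statement) := range maxoid.

Definition generic_maxoids : set (set ci_statement) :=
  [set maxoid C | C in generic].

Definition maxoid_cone C : set 'rV[R]_#|edge| :=
  [set C' | generic C' /\ maxoid C' = maxoid C].

Definition maxoid_fan : set (set 'rV[R]_#|edge|) :=
  [set F | exists2 C, generic C &
    F = closure (maxoid_cone C) \/
    (face F (closure (maxoid_cone C)) /\ F !=set0)].

(* [xget 0] picks some point of the relative interior. *)
Definition cone_maxoid (F : set 'rV[R]_#|edge|) : set ci_statement :=
  maxoid (xget 0 (relative_interior F)).

End Maxoids.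

(* Main.v *)
(** Order the paths of [G] into classes by their pair of ends; the weight of a
    path is linear in [C].  Let [m C] be the set of all critical paths, over
    all classes.  The sets [{D | m C \subset m D}] form a complete fan (the
    normal fan of a Minkowski sum of path polytopes): two of them meet in a face
    of both, cut out by the sum of the inequalities that become equalities, and
    every nonempty face has this form for any of its points minimising [#|m|].
    The relative interior of such a cone is [{D | m D = m C}], and the cone is
    maximal iff [C] is generic.

    The maxoid is a monotone function of [m C], which gives all statements on
    [Phi] except injectivity on maximal cones.  For this, a generic [C] is
    determined by its maxoid: given [i < k < j] in the ancestral order, with
    [L = {x | x <= k, x <> i}], the nodes [i] and [j] are separated given [L]
    iff the critical path from [i] to [j] meets [L], that is, iff its first node
    after [i] is [<= k].  So the maxoid determines the first step of every
    critical path, and by induction the whole path. *)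
Require Import Defs.
From mathcomp Require Import all_boot all_order all_algebra.
From mathcomp Require Import all_classical all_reals all_analysis.
From mathcomp Require Import lra.

Set Implicit Arguments.
Unset Strict Implicit.
Unset Printing Implicit Defensive.

Import Order.TTheory GRing.Theory Num.Theory.
Import numFieldNormedType.Exports.

Local Open Scope classical_set_scope.
Local Open Scope ring_scope.

(** * The dot product: bilinearity, positivity, continuity *)

Section DotProduct.
Variables (R : realType) (n : nat).
Implicit Types a b x y : 'rV[R]_n.

Lemma dotC a x : dot a x = dot x a.
Proof. by apply: eq_bigr => k _; rewrite mulrC. Qed.

Lemma dotDr a x y : dot a (x + y) = dot a x + dot a y.
Proof. by rewrite -big_split; apply: eq_bigr => k _; rewrite mxE mulrDr. Qed.

Lemma dotDl a b x : dot (a + b) x = dot a x + dot b x.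
Proof. by rewrite dotC dotDr !(dotC x). Qed.

Lemma dotZr a s x : dot a (s *: x) = s * dot a x.
Proof. by rewrite mulr_sumr; apply: eq_bigr => k _; rewrite mxE mulrCA. Qed.

Lemma dotNr a x : dot a (- x) = - dot a x.
Proof. by rewrite -scaleN1r dotZr mulN1r. Qed.

Lemma dotBr a x y : dot a (x - y) = dot a x - dot a y.
Proof. by rewrite dotDr dotNr. Qed.

Lemma dot0r a : dot a 0 = 0.
Proof. by rewrite -(scale0r 0) dotZr mul0r. Qed.

Lemma dotBl a b x : dot (a - b) x = dot a x - dot b x.
Proof. by rewrite dotC dotBr !(dotC x). Qed.

Lemma dot_suml (I : Type) (r : seq I) (P : pred I) (f : I -> 'rV[R]_n) x :
  dot (\sum_(i <- r | P i) f i) x = \sum_(i <- r | P i) dot (f i) x.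
Proof.
apply: (big_morph (fun a => dot a x) (fun a b => dotDl a b x)).
by rewrite dotC dot0r.
Qed.

Lemma dot_sumr (I : Type) (r : seq I) (P : pred I) (f : I -> 'rV[R]_n) a :
  dot a (\sum_(i <- r | P i) f i) = \sum_(i <- r | P i) dot a (f i).
Proof. by rewrite dotC dot_suml; apply: eq_bigr => i _; rewrite dotC. Qed.

Lemma dot_xx_gt0 a : a != 0 -> 0 < dot a a.
Proof.
move=> aN0; have [k ak] : exists k, a 0 k != 0.
  apply/existsP; apply: contraNT aN0; rewrite negb_exists => /forallP a0.
  by apply/eqP/rowP => k; rewrite mxE; apply/eqP; have := a0 k; rewrite negbK.
rewrite /dot (bigD1 k) //= ltr_pwDl ?sumr_ge0 // => [|i _].
  by rewrite -expr2 lt_def sqrf_eq0 ak sqr_ge0.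
by rewrite -expr2 sqr_ge0.
Qed.

Lemma dot_continuous a : continuous (dot a).
Proof.
have contsum (s : seq 'I_n) : continuous
    (fun x : 'rV[R]_n => \sum_(k <- s) a 0 k * x 0 k).
  elim: s => [|k s IH].
    under eq_fun do rewrite big_nil.
    exact: cst_continuous.
  under eq_fun do rewrite big_cons.
  move=> x; apply: (@continuousD _ _ _ (fun x : 'rV[R]_n => a 0 k * x 0 k)).
    apply: (@continuousM _ _ (fun=> a 0 k)); first exact: cst_continuous.
    exact: coord_continuous.
  exact: IH.
exact: contsum.
Qed.

Lemma near_ray x d (P : set 'rV[R]_n) :
  (\forall y \near x, P y) -> \forall e \near 0^'+, P (x + e *: d).
Proof.
apply: (_ : (fun e : R => x + e *: d) @ 0^'+ --> x).
rewrite -[X in _ --> X](addr0 x) -(scale0r d).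
apply: (@cvgD _ _ _ _ _ (fun=> x)); first exact: cvg_cst.
apply: cvgZl; apply: cvg_at_right_filter; exact: cvg_id.
Qed.

End DotProduct.

Lemma exists_argmin (I : Type) (A : set I) (f : I -> nat) : A !=set0 ->
  exists2 x, A x & forall y, A y -> (f x <= f y)%N.
Proof.
move=> [x0 Ax0]; have ex : exists k, `[< exists2 x, A x & f x = k >].
  by exists (f x0); apply/asboolP; exists x0.
case: (ex_minnP ex) => k /asboolP[x Ax <-] kmin; exists x => // y Ay.
by apply: kmin; apply/asboolP; exists y.
Qed.

(** * The fan of maximizers for finitely many linear forms grouped in classes *)

Section MaximizerFan.
Variables (R : realType) (n : nat) (W : finType) (T : eqType).
Variables (cl : W -> T) (vec : W -> 'rV[R]_n).
Implicit Types (C D x y : 'rV[R]_n) (u v w : W).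

(** For paths, [cl] will give the two ends and [vec] the edge counts, so that this becomes the set
    of all critical paths. *)
Definition maximizers C : {set W} :=
  [set w | [forall u, (cl u == cl w) ==> (dot (vec u) C <= dot (vec w) C)]].

Definition maximizer_cell C : set 'rV[R]_n :=
  [set D | maximizers D = maximizers C].

Definition maximizer_cone C : set 'rV[R]_n :=
  [set D | maximizers C \subset maximizers D].

Lemma maximizersP C w :
  reflect (forall u, cl u = cl w -> dot (vec u) C <= dot (vec w) C)
          (w \in maximizers C).
Proof.
rewrite inE; apply: (iffP forallP) => [h u uw|h u].
  by have /implyP := h u; apply; apply/eqP.
by apply/implyP => /eqP; exact: h.
Qed.

Lemma maximizers_ex C w : exists2 u, u \in maximizers C & cl u = cl w.
Proof.
case: (@arg_maxP _ _ _ w (fun u => cl u == cl w) (fun u => dot (vec u) C)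
  (eqxx _)) => u /eqP uw umax.
exists u => //; apply/maximizersP => v vu; apply: umax.
by rewrite /= vu uw.
Qed.

Lemma maximizers_ge C w u : w \in maximizers C -> cl u = cl w ->
  dot (vec w) C <= dot (vec u) C -> u \in maximizers C.
Proof.
move=> /maximizersP wC uw le_wu; apply/maximizersP => v vu.
by rewrite (le_trans _ le_wu)// wC// vu.
Qed.

Lemma maximizers_dot C w u : w \in maximizers C -> u \in maximizers C ->
  cl u = cl w -> dot (vec u) C = dot (vec w) C.
Proof.
move=> /maximizersP wC /maximizersP uC uw.
by apply/eqP; rewrite eq_le wC// uC.
Qed.

Lemma maximizers0 : maximizers 0 = [set: W]%SET.
Proof.
by apply/setP => w; rewrite finset.in_setT; apply/maximizersP => u _; rewrite !dot0r.
Qed.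

(* In each class [x] and [y] have a common maximizer, one of [C]. *)
Lemma maximizersD C x y (s t : R) : 0 < s -> 0 < t ->
  maximizer_cone C x -> maximizer_cone C y ->
  maximizers (s *: x + t *: y) = (maximizers x :&: maximizers y)%SET.
Proof.
move=> s0 t0 Cx Cy; apply/setP => w; rewrite finset.in_setI.
apply/idP/andP => [wxy|[/maximizersP wx /maximizersP wy]]; last first.
  apply/maximizersP => u uw; rewrite !dotDr !dotZr.
  by rewrite lerD// ler_pM2l// ?wx ?wy.
have [v vC vw] := maximizers_ex C w.
have vx := fintype.subsetP Cx v vC; have vy := fintype.subsetP Cy v vC.
have := maximizersP _ _ wxy v vw; rewrite !dotDr !dotZr => le1.
have /= := maximizersP _ _ vx w (esym vw); rewrite -(ler_pM2l s0) => le2.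
have /= := maximizersP _ _ vy w (esym vw); rewrite -(ler_pM2l t0) => le3.
split; [apply: (maximizers_ge vx)|apply: (maximizers_ge vy)] => //.
  by rewrite -(ler_pM2l s0); lra.
by rewrite -(ler_pM2l t0); lra.
Qed.

(** Each class has a maximizer of [x]. It belongs to [maximizers C], and the other members of
    [maximizers C] in that class tie with it at [x]. *)
Lemma maximizers_eq C x : maximizers x \subset maximizers C ->
  (forall u v, u \in maximizers C -> v \in maximizers C -> cl u = cl v ->
    dot (vec u) x = dot (vec v) x) ->
  maximizers x = maximizers C.
Proof.
move=> sxC h; apply/eqP; rewrite finset.eqEsubset sxC; apply/fintype.subsetP => w wC.
have [u ux uw] := maximizers_ex x w.
have uC := fintype.subsetP sxC u ux.
by apply: (maximizers_ge ux); rewrite ?uw// (h u w).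
Qed.

Definition simple C : Prop := forall u v,
  u \in maximizers C -> v \in maximizers C -> cl u = cl v -> u = v.

Lemma simple_maximizers_eq C D : simple C ->
  maximizers D \subset maximizers C -> maximizers D = maximizers C.
Proof.
by move=> sC DC; apply: maximizers_eq => // u v uC vC /(sC _ _ uC vC) ->.
Qed.

(** Semicontinuity: a non-maximizer loses strictly to some maximizer of its class, this persists
    nearby by continuity, and [W] is finite. *)
Lemma near_maximizers x : \forall y \near x, maximizers y \subset maximizers x.
Proof.
have outside w : \forall y \near x,
    w \notin maximizers x -> w \notin maximizers y.
  case: (boolP (w \in maximizers x)) => [wx|wNx]; first by apply: filterS filterT.
  have [u ux uw] := maximizers_ex x w.
  have lt_wu : dot (vec w) x < dot (vec u) x.
    by rewrite ltNge; apply: contra wNx => /(maximizers_ge ux); apply.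
  have : \forall y \near x, 0 < dot (vec u - vec w) y.
    apply: (@cvgr_gt _ _ _ (nbhs_filter x) _ (dot (vec u - vec w) x)).
      exact: dot_continuous.
    by rewrite dotBl subr_gt0.
  apply: filterS => y; rewrite dotBl subr_gt0 => lty _.
  by apply: contraL lty => /maximizersP /(_ u uw); rewrite leNgt.
apply: filterS (filter_forall _ outside) => y h.
apply/fintype.subsetP => w; apply: contraTT; exact: h.
Qed.

Lemma near_ray_maximizers x d :
  \forall e \near (0 : R)^'+, maximizers (x + e *: d) \subset maximizers x.
Proof. exact: near_ray (near_maximizers x). Qed.

(** The maximizers of [x] in one class also tie at [d], so a step away from [d] keeps them tied, and
    a small step creates no new maximizer. *)
Lemma near_ray_cone x d : maximizer_cone x d ->
  \forall e \near (0 : R)^'+, maximizers (x - e *: d) = maximizers x.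
Proof.
move=> sxd; apply: filterS (near_ray_maximizers x (- d)) => e.
rewrite scalerN => h; apply: maximizers_eq => // u v ux vx uv.
rewrite !dotBr !dotZr (maximizers_dot vx ux uv).
by rewrite (maximizers_dot (fintype.subsetP sxd v vx) (fintype.subsetP sxd u ux) uv).
Qed.

Lemma closure_maximizer_cell C :
  closure (maximizer_cell C) = maximizer_cone C.
Proof.
apply/seteqP; split=> [D clD|D CD].
  have [D' []] := clD _ (near_maximizers D).
  by rewrite /maximizer_cell /maximizer_cone /= => ->.
(* A small move in the direction [C] breaks the ties at [D] until only the maximizers of [C]
   remain. *)
move=> B nB; near (0 : R)^'+ => e; exists (D + e *: C); split; last first.
  by near: e; exact: near_ray.
have e0 : 0 < e by near: e; exact: nbhs_right_gt.
rewrite /maximizer_cell /= -[D in D + _]scale1r (maximizersD (C := C))//.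
  exact/finset.setIidPr.
exact: subxx.
Unshelve. all: by end_near.
Qed.

(** Nearby points can only lose maximizers, and with one per class there is none to lose. *)
Lemma open_maximizer_cell C : simple C -> open (maximizer_cell C).
Proof.
move=> simpleC; rewrite openE => x Cx.
apply: filterS (near_maximizers x) => y; rewrite /maximizer_cell /= Cx => h.
exact: simple_maximizers_eq.
Qed.

Lemma maximizer_cell_conic C (s t : R) x y : 0 < s -> 0 < t ->
  maximizer_cell C x -> maximizer_cell C y -> maximizer_cell C (s *: x + t *: y).
Proof.
move=> s0 t0 Cx Cy; rewrite /maximizer_cell /= (maximizersD (C := C))//.
- by rewrite Cx Cy finset.setIid.
- by rewrite /maximizer_cone /= Cx.
- by rewrite /maximizer_cone /= Cy.
Qed.

Lemma maximizer_cone_conic C (s t : R) x y : 0 < s -> 0 < t ->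
  maximizer_cone C x -> maximizer_cone C y -> maximizer_cone C (s *: x + t *: y).
Proof.
move=> s0 t0 Cx Cy; rewrite /maximizer_cone /= (maximizersD (C := C))//.
by rewrite finset.subsetI; apply/andP; split.
Qed.

Lemma maximizer_cone_id C : maximizer_cone C C.
Proof. exact: subxx. Qed.

Lemma maximizer_cone_polyhedral C : polyhedral_cone (maximizer_cone C).
Proof.
(* Normals have to be nonzero; the pairs with equal vectors, dropped here, would give trivial
   inequalities. *)
exists [seq vec p.1 - vec p.2 | p <- enum {: W * W} &
   [&& p.1 \in maximizers C, cl p.2 == cl p.1 & vec p.1 != vec p.2]].
  by apply/mapP => -[[w u]]; rewrite mem_filter /= => /andP[/and3P[_ _ wu] _]
    /esym/eqP; rewrite subr_eq0 (negbTE wu).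
apply/seteqP; split=> D /= CD.
  move=> a /mapP [[w u]]; rewrite mem_filter /= => /andP[/and3P[wC /eqP uw _] _] ->.
  by rewrite dotBl subr_ge0; apply/maximizersP: uw; exact: (fintype.subsetP CD).
apply/fintype.subsetP => w wC; apply/maximizersP => u uw.
have [->//|wu] := eqVneq (vec w) (vec u).
rewrite -subr_ge0 -dotBl; apply: CD; apply/mapP; exists (w, u) => //.
by rewrite mem_filter /= wC uw eqxx wu mem_enum.
Qed.

Lemma relative_interior_maximizer_cone C :
  relative_interior (maximizer_cone C) = maximizer_cell C.
Proof.
apply/seteqP; split=> x.
  move=> [Cx]; rewrite near_withinE => /near_ray-/(_ (x - C)) ray.
  near (0 : R)^'+ => e.
  have e0 : 0 < e by near: e; exact: nbhs_right_gt.
  (* The segment from [C] to [x] is prolonged slightly beyond [x]. There [v] still maximizes; as [w]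
     ties with [v] at [x], it cannot lose to [v] at [C]. *)
  have hull_y : affine_hull (maximizer_cone C) (x + e *: (x - C)).
    exists 2, (fun k => if k == ord0 then x else C),
      (fun k => if k == ord0 then 1 + e else - e); split.
    - by move=> k; case: ifP => _ //; exact: maximizer_cone_id.
    - by rewrite big_ord_recl big_ord1 /= addrK.
    - rewrite big_ord_recl big_ord1 /= scalerBr scalerDl scale1r scaleNr.
      by rewrite addrA.
  have Cy : maximizer_cone C (x + e *: (x - C)).
    by move: hull_y; near: e.
  apply/eqP; rewrite finset.eqEsubset andbC [X in X && _]Cx /=.
  apply/fintype.subsetP => w wx; have [v vC vw] := maximizers_ex C w.
  apply: (maximizers_ge vC) => //.
  have := maximizersP _ _ (fintype.subsetP Cy v vC) w (esym vw).
  have := maximizers_dot wx (fintype.subsetP Cx v vC) vw.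
  rewrite !dotDr !dotZr !dotBr => ->.
  by rewrite lerD2l ler_pM2l// lerD2l lerN2.
move=> Cx; split; first by rewrite /maximizer_cone /= Cx.
rewrite near_withinE; apply: filterS (near_maximizers x) => y; rewrite Cx => yC.
(* The ties between maximizers of [C] hold at all points of the cone, hence at their linear
   combination [y]. *)
move=> [m [p [l [Cp _ ey]]]]; rewrite /maximizer_cone /= (maximizers_eq yC)//.
move=> u v uC vC uv; rewrite ey !dot_sumr; apply: eq_bigr => k _.
rewrite !dotZr (maximizers_dot (C := p k) (w := v) (u := u))//.
  exact: (fintype.subsetP (Cp k)).
exact: (fintype.subsetP (Cp k)).
Unshelve. all: by end_near.
Qed.

Lemma face_maximizer_cone C F : face F (maximizer_cone C) -> F !=set0 ->
  exists D, F = maximizer_cone D.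
Proof.
move=> [a [c [valid ->]]] F0.
have cone0 : maximizer_cone C 0.
  by rewrite /maximizer_cone /= maximizers0 finset.subsetT.
(* Validity at the origin gives [c <= 0], and validity at [x + x] gives [c <= 2 * c]. *)
have c0 : c = 0.
  have [x [Cx /= ax]] := F0.
  have := valid _ (maximizer_cone_conic ltr01 ltr01 Cx Cx).
  have := valid _ cone0; rewrite dotDr !dotZr dot0r ax; lra.
rewrite {}c0 in valid F0 *.
have [x [Cx /= ax] xmin] := exists_argmin (fun x => #|maximizers x|) F0.
exists x; apply/seteqP; split=> y.
  (* The sum lies on the face and its maximizers are those common to [x] and [y], so minimality
     makes them all of [maximizers x]. *)
  move=> [Cy /= ay]; have := xmin (1 *: x + 1 *: y).
  rewrite (maximizersD ltr01 ltr01 Cx Cy) => le_card.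
  apply/finset.setIidPl/eqP; rewrite eqEcard finset.subsetIl le_card//.
  split; first exact: maximizer_cone_conic.
  by rewrite /= dotDr !dotZr ax ay !mulr0 addr0.
move=> xy; have Cy : maximizer_cone C y := fintype.subset_trans Cx xy.
split=> //=; apply/eqP; rewrite eq_le valid// andbT.
(* A small step from [x] against [y] stays in the cone; validity there bounds [dot a y] from above
   by 0. *)
near (0 : R)^'+ => e.
have e0 : 0 < e by near: e; exact: nbhs_right_gt.
have : maximizer_cone C (x - e *: y).
  rewrite /maximizer_cone /= (_ : maximizers (x - e *: y) = maximizers x) //.
  by near: e; exact: near_ray_cone.
by move=> /valid; rewrite dotBr dotZr ax sub0r oppr_ge0 pmulr_rle0.
Unshelve. all: by end_near.
Qed.

(** On the cone of [C] all summands of the normal are nonnegative, so a zero sum makes each vanish;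
    then every maximizer of [D] ties with one of [C]. *)
Lemma face_maximizer_coneI C D :
  face (maximizer_cone C `&` maximizer_cone D) (maximizer_cone C).
Proof.
pose P (p : W * W) :=
  [&& p.1 \in maximizers C, p.2 \in maximizers D & cl p.2 == cl p.1].
exists (\sum_(p | P p) (vec p.1 - vec p.2)), 0.
have pos x p : maximizer_cone C x -> P p -> 0 <= dot (vec p.1 - vec p.2) x.
  move=> Cx /and3P[pC _ /eqP p12]; rewrite dotBl subr_ge0.
  exact: (maximizersP _ _ (fintype.subsetP Cx _ pC)).
split=> [x Cx|]; first by rewrite dot_suml sumr_ge0// => p; exact: pos.
apply/seteqP; split=> x [Cx].
  move=> Dx; split=> //=; rewrite dot_suml big1// => p /and3P[pC pD /eqP p12].
  by rewrite dotBl (maximizers_dot (fintype.subsetP Cx _ pC)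
    (fintype.subsetP Dx _ pD) p12) subrr.
rewrite /= dot_suml => /eqP; rewrite psumr_eq0; last by move=> p; exact: pos.
move=> /allP h; split=> //; apply/fintype.subsetP => u uD.
have [v vC vu] := maximizers_ex C u.
have /implyP := h (v, u) (mem_index_enum _).
rewrite /P /= vC uD vu eqxx dotBl subr_eq0 => /(_ isT)/eqP evu.
by apply: (maximizers_ge (fintype.subsetP Cx _ vC)); rewrite ?evu.
Qed.

Lemma maximizer_fan : complete_fan (range maximizer_cone).
Proof.
split; last by apply/seteqP; split=> // C _; exists (maximizer_cone C) => //;
  exact: maximizer_cone_id.
split.
- apply: (@sub_finite_set _ _
    (range (fun S : {set W} => [set D | S \subset maximizers D]))).
    by move=> _ [C _ <-]; exists (maximizers C).
  exact/finite_image/finite_finset.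
- move=> _ [C _ <-]; split; last exact: maximizer_cone_polyhedral.
  by exists C; exact: maximizer_cone_id.
- by move=> F _ [C _ <-] /face_maximizer_cone/[apply] -[D ->]; exists D.
- move=> _ _ [C _ <-] [D _ <-]; split; last rewrite setIC;
    exact: face_maximizer_coneI.
Qed.

(** * Simple points and maximal cones *)

Hypothesis vec_inj : forall u v, cl u = cl v -> vec u = vec v -> u = v.

(** Among points whose cone contains [C], take one with fewest maximizers. If [u] and [v] tied
    there, a small move along [vec u - vec v] would discard [v]. *)
Lemma simple_perturbation C : exists2 D, simple D & maximizer_cone D C.
Proof.
have [|x xC xmin] := @exists_argmin _ [set x | maximizer_cone x C]
  (fun x => #|maximizers x|); first by exists C; exact: maximizer_cone_id.
exists x => // u v ux vx uv; apply: contrapT => uNv.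
near (0 : R)^'+ => e.
have e0 : 0 < e by near: e; exact: nbhs_right_gt.
pose y := x + e *: (vec u - vec v).
have yx : maximizers y \subset maximizers x.
  by rewrite /y; near: e; exact: near_ray_maximizers.
have := xmin y (fintype.subset_trans yx xC); apply/negP; rewrite -ltnNge.
apply: proper_card; rewrite finset.properEneq yx andbT.
have d0 : 0 < dot (vec u - vec v) (vec u - vec v).
  by apply: dot_xx_gt0; rewrite subr_eq0; apply/eqP => /(vec_inj uv).
have vNy : v \notin maximizers y.
  apply/maximizersP => /(_ u uv); rewrite /y !dotDr !dotZr.
  rewrite (maximizers_dot vx ux uv) lerD2l ler_pM2l//.
  by rewrite -subr_le0 -dotBl leNgt d0.
by apply: contraNneq vNy => ->.
Unshelve. all: by end_near.
Qed.

Lemma maximizer_fanE : range maximizer_cone =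
  [set F | exists2 C, simple C & F = closure (maximizer_cell C) \/
    (face F (closure (maximizer_cell C)) /\ F !=set0)].
Proof.
apply/seteqP; split=> F /=.
  move=> [C _ <-]; have [D sD DC] := simple_perturbation C.
  exists D => //; right; rewrite closure_maximizer_cell; split; last first.
    by exists C; exact: maximizer_cone_id.
  rewrite (_ : maximizer_cone C = maximizer_cone D `&` maximizer_cone C).
    exact: face_maximizer_coneI.
  apply/seteqP; split=> [x Cx|x []//]; split=> //.
  exact: fintype.subset_trans DC Cx.
move=> [C sC]; rewrite closure_maximizer_cell => -[->|[]]; first by exists C.
by move=> /face_maximizer_cone/[apply] -[D ->]; exists D.
Qed.

Lemma maximal_maximizer_cones :
  maximal_cones (range maximizer_cone) = [set maximizer_cone C | C in simple].
Proof.
apply/seteqP; split=> F /=.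
  move=> [[C _ <-] Cmax]; have [D sD DC] := simple_perturbation C.
  exists D => //; apply: Cmax => [|x Cx]; first by exists D.
  exact: fintype.subset_trans DC Cx.
move=> [C sC <-]; split=> [|_ [D _ <-] sCD]; first by exists C.
have DC : maximizers D \subset maximizers C := sCD _ (maximizer_cone_id C).
by rewrite /maximizer_cone (simple_maximizers_eq sC DC).
Qed.

End MaximizerFan.

Lemma mem_zip_fst (S T : eqType) (s : seq S) (t : seq T) x y :
  (x, y) \in zip s t -> x \in s.
Proof.
elim: s t => [|a s IH] [|b t] //; rewrite !in_cons xpair_eqE.
by case/orP => [/andP[-> //]|/IH ->]; rewrite orbT.
Qed.

(** * Critical paths as maximizers of linear forms *)

Section CriticalPaths.
Variables (R : realType) (V : finType) (E : rel V).
Hypothesis acyclicE : acyclic E.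
Implicit Types (C D : 'rV[R]_#|edge E|) (L : {set V}) (i j : V) (p q : seq V).

Lemma closed_path_nil i p : path E i p -> last i p = i -> p = [::].
Proof.
case/lastP: p => // p x; rewrite last_rcons => Ep xi; rewrite xi in Ep *.
by have /acyclicE := Ep : cycle E (i :: p).
Qed.

Lemma path_notin i p : path E i p -> i \notin p.
Proof.
move=> Ep; apply/negP => ip; case/path.splitP: ip Ep => p1 p2.
rewrite cat_path => /andP[Ep1 _].
by have /(congr1 size) := closed_path_nil Ep1 (last_rcons _ _ _); rewrite size_rcons.
Qed.

Lemma path_uniq i p : path E i p -> uniq (i :: p).
Proof.
elim: p i => [//|a p IH] i Ep; rewrite cons_uniq path_notin//=.
by case/andP: Ep => _ /IH.
Qed.

Lemma path_size i p : path E i p -> (size p <= #|V|)%N.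
Proof.
by move=> /path_uniq/andP[_ up]; rewrite -(card_uniqP up) max_card.
Qed.

Lemma connect_antisym i j : connect E i j -> connect E j i -> i = j.
Proof.
move=> /connectP[p Ep ej] /connectP[q Eq ei].
have /closed_path_nil : path E i (p ++ q) by rewrite cat_path Ep -ej.
by rewrite last_cat -ej => /(_ (esym ei)) /(congr1 size); rewrite ej; case: (p).
Qed.

(** Acyclicity bounds the length of a path by [#|V|], so bounded sequences capture all paths in a
    finite type. *)
Definition edge_path : finType :=
  {w : V * {bseq #|V| of V} | path E w.1 w.2}.

Definition source (w : edge_path) : V := (val w).1.
Definition nodes (w : edge_path) : seq V := (val w).2.
Definition ends (w : edge_path) : V * V := (source w, last (source w) (nodes w)).

Lemma nodes_path (w : edge_path) : path E (source w) (nodes w).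
Proof. exact: valP w. Qed.

Lemma edge_path_ex i p : path E i p ->
  exists2 w : edge_path, source w = i & nodes w = p.
Proof.
move=> Ep.
by exists (exist (fun w : V * {bseq #|V| of V} => path E w.1 w.2)
  (i, Bseq (path_size Ep)) Ep).
Qed.

Lemma edge_path_inj (u w : edge_path) :
  source u = source w -> nodes u = nodes w -> u = w.
Proof.
case: u w => [[i p] Ep] [[j q] Eq]; rewrite /source /nodes /= => ij pq.
by apply: val_inj; rewrite /= ij; congr pair; apply: val_inj.
Qed.

Definition path_vector i p : 'rV[R]_#|edge E| :=
  \row_k (count_mem (val (enum_val k)) (zip (i :: p) p))%:R.

Definition edge_path_vector (w : edge_path) := path_vector (source w) (nodes w).

Lemma path_weightE C i p : path E i p ->
  path_weight C i p = (dot (path_vector i p) C)%:E.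
Proof.
elim: p i => [|a p IH] i.
  rewrite /path_weight big_nil dotC /dot big1// => k _.
  by rewrite mxE mulr0.
move=> /= /andP[Eia Ep]; rewrite /path_weight big_cons -/(path_weight C a p) IH//.
rewrite /weight_entry insubT /= -EFinD; congr EFin.
set e := Sub _ _.
have -> : path_vector i (a :: p) = delta_mx 0 (enum_rank e) + path_vector a p.
  apply/rowP => k; rewrite !mxE /= natrD; congr (_ + _).
  rewrite -(inj_eq enum_val_inj) enum_rankK -(inj_eq val_inj) /=.
  by rewrite [X in X%:R = _]/= eq_sym.
rewrite dotDl; congr (_ + _).
rewrite /dot (bigD1 (enum_rank e))//= mxE !eqxx mul1r big1 ?addr0// => k kNe.
by rewrite mxE eqxx (negbTE kNe) mul0r.
Qed.

Lemma path_vector_inj i p q : path E i p -> path E i q ->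
  path_vector i p = path_vector i q -> p = q.
Proof.
move=> Ep Eq epq.
have {epq} count_eq e : E e.1 e.2 ->
    count_mem e (zip (i :: p) p) = count_mem e (zip (i :: q) q).
  move=> Ee; have := congr1 (fun M : 'rV[R]__ => M 0 (enum_rank (Sub e Ee : edge E))) epq.
  by rewrite !mxE enum_rankK SubK => /eqP; rewrite eqr_nat => /eqP.
elim: p i q Ep Eq count_eq => [|a p IH] i [|b q] //=.
- by move=> _ /andP[Eib _] /(_ (i, b) Eib); rewrite eqxx.
- by move=> /andP[Eia _] _ /(_ (i, a) Eia); rewrite eqxx.
move=> /andP[Eia Ep] /andP[Eib Eq] count_eq.
(* The source [i] never recurs on a path, so the only counted edge leaving [i] is the first one. *)
have ab : a = b.
  have := count_eq (i, a) Eia; rewrite eqxx xpair_eqE eqxx /=.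
  have [//|ba] := eqVneq b a; rewrite add1n add0n => cnt.
  have : (i, a) \in zip (b :: q) q by rewrite -has_pred1 has_count -cnt.
  move/mem_zip_fst.
  by have := @path_notin i (b :: q); rewrite /= Eib Eq => /(_ isT)/negbTE ->.
rewrite -{}ab in Eib Eq count_eq *; congr cons; apply: (IH a) => // e Ee.
by have /addnI := count_eq e Ee.
Qed.

Lemma edge_path_vector_inj (u w : edge_path) : ends u = ends w ->
  edge_path_vector u = edge_path_vector w -> u = w.
Proof.
move=> [su _] euw; apply: edge_path_inj => //.
move: (nodes_path u) euw; rewrite /edge_path_vector su => Eu.
exact: path_vector_inj Eu (nodes_path w).
Qed.

Local Notation argmax := (maximizers ends edge_path_vector).

Lemma maximizers_critical C (w : edge_path) :
  w \in argmax C <-> critical C (ends w).1 (ends w).2 (nodes w).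
Proof.
have dw : dipath E (ends w).1 (ends w).2 (nodes w).
  by rewrite /dipath nodes_path eqxx.
split=> [/maximizersP wC|[_ wC]].
  split=> // q /andP[/= Eq /eqP lq]; rewrite !path_weightE ?nodes_path// lee_fin.
  have [u su nu] := edge_path_ex Eq; rewrite -{1}su -nu.
  by apply: wC; rewrite /ends su nu lq.
apply/maximizersP => u [su lu]; rewrite -lee_fin -!path_weightE ?nodes_path//.
by rewrite su; apply: wC; rewrite /dipath /= -lu -su nodes_path eqxx.
Qed.

Lemma critical_maximizers C i j p : critical C i j p ->
  exists w, [/\ w \in argmax C, ends w = (i, j) & nodes w = p].
Proof.
move=> pC; have [/andP[Ep /eqP lp] _] := pC.
have [w sw nw] := edge_path_ex Ep.
have ew : ends w = (i, j) by rewrite /ends sw nw lp.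
by exists w; split=> //; apply/maximizers_critical; rewrite ew nw.
Qed.

Lemma critical_ex C i j p : dipath E i j p -> exists q, critical C i j q.
Proof.
case/andP=> Ep /eqP lp; have [w sw nw] := edge_path_ex Ep.
have [u /maximizers_critical uC uw] := maximizers_ex ends edge_path_vector C w.
by exists (nodes u); rewrite uw /ends sw nw lp in uC.
Qed.

Lemma sub_maximizersP C D : reflect
  (forall i j p, critical C i j p -> critical D i j p) (argmax C \subset argmax D).
Proof.
apply: (iffP fintype.subsetP) => [CD i j p|CD w].
  move=> /critical_maximizers[w [wC [<- <-] <-]].
  by apply/maximizers_critical/CD.
by move=> /maximizers_critical/CD/maximizers_critical.
Qed.

Lemma generic_simple C : generic C <-> simple ends edge_path_vector C.
Proof.
split=> [gC u w uC wC uw|sC i j ij [p ijp]].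
  have [su lu] := uw; apply: edge_path_inj => //.
  (* [generic] concerns distinct ends only; for equal ends the empty path is the sole candidate. *)
  have [ij|ij] := eqVneq (ends w).1 (ends w).2.
    have iju : (ends u).1 = (ends u).2 by rewrite uw.
    rewrite (closed_path_nil (nodes_path w) (esym ij)).
    by rewrite (closed_path_nil (nodes_path u) (esym iju)).
  move: uC wC => /maximizers_critical + /maximizers_critical wC; rewrite uw => uC.
  have [|p [_ puniq]] := gC _ _ ij; first by exists (nodes w); case: wC.
  by rewrite -(puniq _ uC) (puniq _ wC).
have [q qC] := critical_ex C ijp.
exists q; split=> // r /critical_maximizers[w [wC we <-]].
have /critical_maximizers[u [uC ue <-]] := qC.
by rewrite (sC u w)// ue we.
Qed.

(** More critical paths give [L] more opportunities to block an edge. *)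
Lemma critical_edge_anti C D L i j : argmax C \subset argmax D ->
  critical_edge D L i j -> critical_edge C L i j.
Proof.
move=> /sub_maximizersP CD [ij ijp DL]; split=> // p /CD; exact: DL.
Qed.

Lemma star_path_anti C D L i j : argmax C \subset argmax D ->
  star_path D L i j -> star_path C L i j.
Proof.
move=> CD; have sub a b : critical_edge D L a b -> critical_edge C L a b.
  exact: critical_edge_anti.
case=> [/sub|[[p [pL /sub pi /sub pj]]|[[l [lL /sub il /sub jl]]|[|]]]].
- by left.
- by right; left; exists p.
- by do 2!right; left; exists l.
- move=> [p [l [pL lL [/sub pi /sub pl /sub jl]]]].
  by do 3!right; left; exists p, l.
- move=> [p [l [q [pL lL qL [/sub pi /sub pl /sub ql /sub qj]]]]].
  by do 4!right; exists p, l, q.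
Qed.

Lemma maxoid_mono C D : argmax C \subset argmax D -> maxoid C `<=` maxoid D.
Proof.
move=> CD [[A B] L] [AB AL BL sep]; split=> // i j iA jB conD.
apply: (sep i j) => //.
by case: conD => /(star_path_anti CD); [left|right].
Qed.

(** * Recovering critical paths from the maxoid *)

Lemma critical_edge_connect C L i j :
  critical_edge C L i j -> connect E i j /\ i != j.
Proof.
by move=> [ij [p /andP[Ep /eqP lp]] _]; split=> //; apply/connectP; exists p.
Qed.

(* All ancestors of [i] lie in [L] and no descendant of [j] does, so that a
   connecting path can only start with an edge from [i] to [j]. *)
Lemma star_connected_ancestors C i j k (L := [set x | connect E x k & x != i]%SET) :
  i != k -> connect E i k -> k != j -> connect E k j ->
  star_connected C L i j <-> critical_edge C L i j.
Proof.
move=> ik Eik kj Ekj; split; last by left; left.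
have anc (p : V) : p \notin L -> critical_edge C L p i -> False.
  move=> + /critical_edge_connect[Epi pi].
  by rewrite inE pi (connect_trans Epi Eik).
have desc l : l \in L -> critical_edge C L j l -> False.
  rewrite inE => /andP[Elk _] /critical_edge_connect[Ejl _].
  by move: kj; rewrite (connect_antisym Ekj (connect_trans Ejl Elk)) eqxx.
case; case=> [//|[[p [pL Gp Gp']]|[[l [lL Gl Gl']]|[|]]]].
- by case: (anc p pL Gp).
- by case: (desc l lL Gl').
- by move=> [p [l [pL lL [Gp _ _]]]]; case: (anc p pL Gp).
- by move=> [p [l [q [pL _ _ [Gp _ _ _]]]]]; case: (anc p pL Gp).
- move=> /critical_edge_connect[Eji _].
  by move: kj; rewrite (connect_antisym Ekj (connect_trans Eji Eik)) eqxx.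
- by case: (anc p pL Gp').
- by case: (desc l lL Gl).
(* Here [p] is an ancestor of [k] through [l] but lies outside [L], which forces [p = i]. *)
- move=> [p [l [pL lL [Gpj /critical_edge_connect[Epl _] _]]]].
  move: lL pL; rewrite !inE => /andP[Elk _].
  by rewrite (connect_trans Epl Elk) negbK => /eqP <-.
- by move=> [p [l [q [_ _ qL [_ _ _ Gq]]]]]; case: (anc q qL Gq).
Qed.

(** Reads a single edge of the critical DAG off the maxoid. The triple is a legal statement: [L]
    omits [i] by definition and [j] by acyclicity. *)
Lemma maxoid_ancestors C i j k (L := [set x | connect E x k & x != i]%SET) :
  i != k -> connect E i k -> k != j -> connect E k j ->
  maxoid C ([set i], [set j], L)%SET <-> ~ critical_edge C L i j.
Proof.
move=> ik Eik kj Ekj.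
have conE := star_connected_ancestors C ik Eik kj Ekj.
have ij : i != j.
  by apply: contraNneq kj => ij; rewrite -ij in Ekj *; rewrite (connect_antisym Eik Ekj).
have jk : ~~ connect E j k.
  by apply: contraNN kj => Ejk; rewrite (connect_antisym Ejk Ekj).
split=> [[_ _ _ sep] /conE|nedge]; first by apply: sep; rewrite finset.set11.
split; rewrite ?disjoints1 ?inE ?eqxx ?andbF ?(negbTE jk)// => a b.
by rewrite !inE => /eqP -> /eqP -> /conE.
Qed.

Lemma critical_behead C i j a p : critical C i j (a :: p) -> critical C a j p.
Proof.
move=> [/andP[/= /andP[Eia Ep] lp] pC].
split=> [|q /andP[Eq lq]]; first by rewrite /dipath Ep lp.
have := pC (a :: q); rewrite /dipath /= Eia Eq lq => /(_ isT).
rewrite /path_weight /= !big_cons -/(path_weight C a p) -/(path_weight C a q).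
(* The first edge has finite weight, so it cancels. *)
by rewrite /weight_entry insubT leeD2lE.
Qed.

Lemma critical_connect C i j a p : critical C i j (a :: p) -> connect E a j.
Proof.
by move=> /critical_behead[/andP[Ep /eqP lp] _]; apply/connectP; exists p.
Qed.

Lemma critical_neq C i j a p : critical C i j (a :: p) -> i != j.
Proof.
move=> [/andP[Ep /eqP lp] _]; apply/eqP => ij.
by have := closed_path_nil Ep (etrans lp (esym ij)).
Qed.

(* If [a] is an interior node, then [L := {x | x <= a, x <> i}] meets the
   critical path of [C], hence that of [D], whose nodes all descend from [b]. *)
Lemma first_step_le C D i j a b p q : generic D -> maxoid D `<=` maxoid C ->
  maxoid C `<=` maxoid D ->
  critical C i j (a :: p) -> critical D i j (b :: q) -> connect E b a.
Proof.
move=> gD DC CD pC qD; have [-> |aj] := eqVneq a j; first exact: critical_connect qD.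
have [/andP[Eap /= lp] _] := pC.
have ia : i != a.
  by have := path_notin Eap; rewrite in_cons negb_or => /andP[].
have Eia : connect E i a by case/andP: Eap => /connect1.
have Eaj := critical_connect pC.
have a_int : a \in interior_nodes i (a :: p).
  case: p lp {pC Eap} => [|c p _]; first by rewrite /= (negbTE aj).
  by rewrite /interior_nodes /= in_cons eqxx.
have /CD : maxoid C ([set i], [set j], [set x | connect E x a & x != i])%SET.
  apply/maxoid_ancestors => // -[_ _ /(_ _ pC a a_int)].
  by rewrite inE connect0 eq_sym ia.
move=> /(maxoid_ancestors D ia Eia aj Eaj) nedge.
(* If [b] did not reach [a], no node after [i] on the path of [D] would, so [L] would miss that
   path. *)
apply/negPn/negP => nba; apply: nedge.
have [dq _] := qD; have ij := critical_neq qD.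
split=> //; first by exists (b :: q).
move=> r rD x xr; have [|s [_ suniq]] := gD _ _ ij; first by exists (b :: q).
have {}xr : x \in b :: q.
  move: xr; rewrite -(suniq _ rD) (suniq _ qD) /interior_nodes /=.
  exact: mem_belast.
rewrite inE negb_and; apply/orP; left; apply: contraNN nba => Exa.
apply: connect_trans Exa; have /andP[/= /andP[_ Eq] _] := dq.
exact: path_connect Eq _ xr.
Qed.

(** The two first steps reach each other, so they agree by acyclicity; the tails are again
    critical. *)
Lemma generic_maxoid_critical C D i j p q : generic C -> generic D ->
  maxoid C = maxoid D -> critical C i j p -> critical D i j q -> p = q.
Proof.
move=> gC gD CD; elim: p i q => [|a p IH] i [|b q] // pC qD.
- by case: pC => /andP[_ /eqP /= ij] _; have := critical_neq qD; rewrite ij eqxx.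
- by case: qD => /andP[_ /eqP /= ij] _; have := critical_neq pC; rewrite ij eqxx.
have ab : a = b.
  by apply: connect_antisym; [apply: (first_step_le gC _ _ qD pC)|
    apply: (first_step_le gD _ _ pC qD)]; rewrite CD.
rewrite -{}ab in qD *; congr cons.
exact: IH (critical_behead pC) (critical_behead qD).
Qed.

Lemma generic_maxoid_maximizers C D : generic C -> generic D ->
  maxoid C = maxoid D -> argmax C = argmax D.
Proof.
have sub C' D' : generic C' -> generic D' -> maxoid C' = maxoid D' ->
    argmax C' \subset argmax D'.
  move=> gC gD CD; apply/sub_maximizersP => i j p pC.
  have [q qD] : exists q, critical D' i j q.
    by apply: (@critical_ex _ _ _ p); case: pC.
  by rewrite (generic_maxoid_critical gC gD CD pC qD).
by move=> gC gD CD; apply/eqP; rewrite finset.eqEsubset !sub.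
Qed.

(** * Transfer of the fan to maxoids *)

Lemma eq_maximizers_maxoid C D : argmax C = argmax D -> maxoid C = maxoid D.
Proof.
by move=> CD; apply/seteqP; split; apply: maxoid_mono; rewrite CD.
Qed.

Lemma maxoid_coneE C : generic C ->
  maxoid_cone C = maximizer_cell ends edge_path_vector C.
Proof.
move=> gC; apply/seteqP; split=> D; rewrite /maxoid_cone /maximizer_cell /=.
  by move=> [gD DC]; exact: generic_maxoid_maximizers.
move=> DC; split; last exact: eq_maximizers_maxoid.
by move/generic_simple: gC => sC; apply/generic_simple; rewrite /simple DC.
Qed.

Local Notation cone := (maximizer_cone ends edge_path_vector).

Lemma maxoid_fanE : @maxoid_fan R V E = range cone.
Proof.
rewrite (maximizer_fanE edge_path_vector_inj); apply/seteqP.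
split=> F [C gC FC]; exists C.
- exact/generic_simple.
- by rewrite -maxoid_coneE.
- exact/generic_simple.
- by rewrite maxoid_coneE//; apply/generic_simple.
Qed.

Lemma cone_maxoidE C : cone_maxoid (cone C) = maxoid C.
Proof.
apply: eq_maximizers_maxoid; rewrite relative_interior_maximizer_cone.
(* The cell contains [C], so [xget] does not fall back on its default 0. *)
by apply: (@xgetPex _ 0 (maximizer_cell ends edge_path_vector C)); exists C.
Qed.

End CriticalPaths.

Theorem corollary2p13 (R : realType) (V : finType) (E : rel V)
    (acyclicE : acyclic E) :
  (forall C : 'rV[R]_#|edge E|, generic C -> open_cone (maxoid_cone C)) /\
  complete_fan (@maxoid_fan R V E) /\
  set_bij (maximal_cones (@maxoid_fan R V E)) (@generic_maxoids R V E)
    (@cone_maxoid R V E) /\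
  (forall F : set 'rV[R]_#|edge E|, maxoid_fan F ->
     (relative_interior F !=set0)%classic /\
     forall C, relative_interior F C -> cone_maxoid F = maxoid C) /\
  (@cone_maxoid R V E @` @maxoid_fan R V E = @maxoids R V E)%classic /\
  (forall F1 F2 : set 'rV[R]_#|edge E|, maxoid_fan F1 -> maxoid_fan F2 ->
     face F1 F2 -> (cone_maxoid F2 `<=` cone_maxoid F1)%classic).
Proof.
rewrite (maxoid_fanE R acyclicE); split.
  move=> C gC; rewrite maxoid_coneE//; split.
    exact/open_maximizer_cell/generic_simple.
  by move=> s t x y; exact: maximizer_cell_conic.
split; first exact: maximizer_fan.
split.
  rewrite (maximal_maximizer_cones (@edge_path_vector_inj R V E acyclicE)).
  split.
  - move=> _ [C sC <-]; rewrite (cone_maxoidE acyclicE); exists C => //.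
    exact/(generic_simple acyclicE).
  - move=> F G /set_mem[C sC <-] /set_mem[D sD <-]; rewrite !(cone_maxoidE acyclicE) => CD.
    rewrite /maximizer_cone (@generic_maxoid_maximizers _ _ _ acyclicE C D) //.
      exact/(generic_simple acyclicE).
    exact/(generic_simple acyclicE).
  - move=> _ [C gC <-].
    exists (maximizer_cone (@ends V E) (@edge_path_vector R V E) C).
      by exists C => //; apply/(generic_simple acyclicE).
    by rewrite (cone_maxoidE acyclicE).
split.
  move=> _ [C _ <-]; rewrite relative_interior_maximizer_cone (cone_maxoidE acyclicE).
  by split; [exists C|move=> D DC; apply: (eq_maximizers_maxoid acyclicE)].
split.
  apply/seteqP; split=> [_ [_ [C _ <-] <-]|_ [C _ <-]].
    by rewrite (cone_maxoidE acyclicE); exists C.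
  exists (maximizer_cone (@ends V E) (@edge_path_vector R V E) C).
    by exists C.
  by rewrite (cone_maxoidE acyclicE).
move=> _ _ [C _ <-] [D _ <-] [a [c [_ CD]]].
rewrite !(cone_maxoidE acyclicE); apply: (maxoid_mono acyclicE) => //.
(* [C] lies in its own cone, hence in that of [D], so the maximizers of [D] are among those of
   [C]. *)
by have := maximizer_cone_id (@ends V E) (@edge_path_vector R V E) C; rewrite CD => -[].
Qed.
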